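(* Let $\mathbb{K}$ be a field and let $m\geq 3$ be an integer. For every integer $t\geq 1$ let $\mathcal{G}_t=P_m*K_t$ be the join product of the path $P_m$ on $m$ vertices and the complete graph $K_t$ on $t$ vertices. Then $\{\mathcal{G}_t\}_{t=1}^{\infty}$ is an infinite family of strongly interval graphs for which $$\lim_{t\to\infty}\frac{c(\mathcal{G}_t)}{|V(\mathcal{G}_t)|-2}=\lim_{t\to\infty}\frac{c(\mathcal{G}_t)}{\deg h_{\mathcal{G}_t}(\lambda)}=0.$$
   Context: All graphs are finite and simple. The join product $G_1*G_2$ of two graphs on disjoint vertex sets is the graph on $V(G_1)\cup V(G_2)$ with edge set $E(G_1)\cup E(G_2)\cup\{\{u,v\}:u\in V(G_1),\ v\in V(G_2)\}$. $c(G)$ denotes the number of maximal cliques of $G$. For a graph $G$ with vertex set identified with $\{1,\ldots,n\}$, the binomial edge ideal $J_G$ is the ideal of $S=\mathbb{K}[x_1,\ldots,x_n,y_1,\ldots,y_n]$ (standard grading) generated by all $x_iy_j-x_jy_i$ with $\{i,j\}\in E(G)$, $1\leq i<j\leq n$. The Hilbert series of $S/J_G$ is written uniquely as $h_G(\lambda)/(1-\lambda)^d$ with $h_G(\lambda)\in\mathbb{Z}[\lambda]$ and $d=\dim S/J_G$ (Krull dimension); $h_G(\lambda)$ is called the h-polynomial of $S/J_G$. Interval graph on a finite family of real closed intervals: each vertex is labeled by a real closed interval (the family is indexed, one vertex per index), and two distinct vertices are adjacent if and only if their intervals have non-empty intersection. Write $\mathbb{N}_0=\mathbb{N}\cup\{0\}$,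 with $\mathbb{N}=\{1,2,\ldots\}$. Connected strongly interval graph: let $k\in\mathbb{N}$ and $r\in\mathbb{N}_0$; let $J_0=[0]=\{0\}$, $J_i=[i-1,i]$ for $i=1,\ldots,k$, and let $I_j=[a_j,b_j]$ ($a_j\leq b_j$ real) be such that $a_j\in\mathbb{N}_0$ and $I_j\subseteq[0,k]\setminus\{k\}$ for all $j=1,\ldots,r$. The interval graph on the vertex set $\{J_i\}_{i=0}^{k}\cup\{I_j\}_{j=1}^{r}$ is called a connected strongly interval graph. A graph is called a strongly interval graph if every connected component of it is isomorphic to a connected strongly interval graph (for some $k$, $r$ and intervals depending on the component). *)

(* Defs.v *)
From HB Require Import structures.
(* mpoly must be imported before the analysis files: in the other order the
   notation levels conflict. *)
From mathcomp Require Import all_boot all_order all_algebra mpoly.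
From mathcomp Require Import boolp classical_sets set_interval reals.
From mathcomp Require Import topology normedtype sequences.

Set Implicit Arguments.
Unset Strict Implicit.
Unset Printing Implicit Defensive.

Import Order.TTheory GRing.Theory Num.Theory.
Import numFieldNormedType.Exports.

Local Open Scope ring_scope.

Section Graphs.

Record sgraph := SGraph {
  vertex :> finType;
  adj : rel vertex;
  adj_sym : ssrbool.symmetric adj;
  adj_irr : irreflexive adj
}.

Definition giso (G H : sgraph) : Prop :=
  exists2 f : G -> H, bijective f & forall x y, adj (f x) (f y) = adj x y.

Definition clique (G : sgraph) (A : {set G}) : bool :=
  [forall x in A, forall y in A, (x != y) ==> adj x y].

Definition nb_maximal_cliques (G : sgraph) : nat :=
  #|[set A : {set G} | maxset (@clique G) A]|.

Definition path_adj n : rel 'I_n := fun i j => (i.+1 == j) || (j.+1 == i).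

Lemma path_adj_sym n : ssrbool.symmetric (@path_adj n).
Proof. by move=> i j; rewrite /path_adj orbC. Qed.

Lemma path_adj_irr n : irreflexive (@path_adj n).
Proof. by move=> i; rewrite /path_adj orbb gtn_eqF. Qed.

Definition path_graph n := SGraph (@path_adj_sym n) (@path_adj_irr n).

Definition complete_adj n : rel 'I_n := fun i j => i != j.

Lemma complete_adj_sym n : ssrbool.symmetric (@complete_adj n).
Proof. by move=> i j; rewrite /complete_adj eq_sym. Qed.

Lemma complete_adj_irr n : irreflexive (@complete_adj n).
Proof. by move=> i; rewrite /complete_adj eqxx. Qed.

Definition complete_graph n := SGraph (@complete_adj_sym n) (@complete_adj_irr n).

Definition join_adj (G H : sgraph) : rel (G + H)%type := fun u v =>
  match u, v with
  | inl x, inl y => adj x y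
  | inr x, inr y => adj x y
  | _, _ => true
  end.

Lemma join_adj_sym G H : ssrbool.symmetric (@join_adj G H).
Proof. by move=> [x|x] [y|y] //=; rewrite adj_sym. Qed.

Lemma join_adj_irr G H : irreflexive (@join_adj G H).
Proof. by move=> [x|x] /=; rewrite adj_irr. Qed.

Definition join (G H : sgraph) := SGraph (@join_adj_sym G H) (@join_adj_irr G H).

Definition induced_adj (G : sgraph) (P : pred G) : rel {x : G | P x} :=
  fun x y => adj (val x) (val y).

Lemma induced_adj_sym G P : ssrbool.symmetric (@induced_adj G P).
Proof. by move=> x y; rewrite /induced_adj adj_sym. Qed.

Lemma induced_adj_irr G P : irreflexive (@induced_adj G P).
Proof. by move=> x; rewrite /induced_adj adj_irr. Qed.

Definition induced G P := SGraph (@induced_adj_sym G P) (@induced_adj_irr G P).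

Definition component (G : sgraph) (v : G) : sgraph :=
  @induced G (connect (@adj G) v).

End Graphs.

Section IntervalGraphs.
Local Open Scope classical_set_scope.
Variable R : realType.

Definition interval_adj (I : finType) (f : I -> set R) : rel I :=
  fun i j => (i != j) && `[< f i `&` f j !=set0 >].

Lemma interval_adj_sym I f : ssrbool.symmetric (@interval_adj I f).
Proof. by move=> i j; rewrite /interval_adj eq_sym setIC. Qed.

Lemma interval_adj_irr I f : irreflexive (@interval_adj I f).
Proof. by move=> i; rewrite /interval_adj eqxx. Qed.

Definition interval_graph (I : finType) (f : I -> set R) :=
  SGraph (@interval_adj_sym I f) (@interval_adj_irr I f).

(* The intervals J_0, ..., J_k followed by I_1, ..., I_r.  Since 0.-1 = 0, the
   formula for J_i also gives J_0 = [0, 0]. *)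
Definition strongly_interval_family (k r : nat) (a b : 'I_r -> R)
    (v : 'I_k.+1 + 'I_r) : set R :=
  match v with
  | inl i => [set` `[(i.-1)%:R, i%:R]]
  | inr j => [set` `[a j, b j]]
  end.

Definition connected_strongly_interval (G : sgraph) : Prop :=
  exists (k r : nat) (a b : 'I_r -> R),
    [/\ (1 <= k)%N,
        forall j, a j <= b j,
        forall j, exists n : nat, a j = n%:R,
        forall j, [set` `[a j, b j]] `<=` [set` `[0, k%:R]] `\` [set k%:R] &
        giso G (interval_graph (@strongly_interval_family k r a b))].

Definition strongly_interval (G : sgraph) : Prop :=
  forall v : G, connected_strongly_interval (component v).

End IntervalGraphs.

Section HPolynomial.
Local Open Scope quotient_scope.

Definition prime_chain (A : comNzRingType) (l : nat)
    (p : 'I_l.+1 -> prime_idealr A) : Prop :=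
  forall i j : 'I_l.+1, (i < j)%N ->
    {subset p i <= p j} /\ ~ {subset p j <= p i}.

(* In ring_quotient, ideals are proper by definition, so that prime_idealr A is
   the type of prime ideals of A in the usual sense. *)
Definition krull_dim (A : comNzRingType) (d : nat) : Prop :=
  (exists p, @prime_chain A d p) /\
  (forall l p, @prime_chain A l p -> (l <= d)%N).

(* The dimension over K of the degree i component of {mpoly K[n]} / J, i.e. of
   the image of the forms of degree i: the classes of b_0, ..., b_(N-1) form a
   basis of it. *)
Definition graded_dim (K : fieldType) (n : nat) (J : idealr {mpoly K[n]})
    (i N : nat) : Prop :=
  exists b : 'I_N -> {mpoly K[n]},
    [/\ forall j, b j \is i.-homog,
        forall c : 'I_N -> K,
          \sum_j c j *: b j = 0 %[mod {ideal_quot J}] -> forall j, c j = 0 &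
        forall p : {mpoly K[n]}, p \is i.-homog ->
          exists c : 'I_N -> K, p = \sum_j c j *: b j %[mod {ideal_quot J}]].

(* With H the Hilbert function and d the Krull dimension of {mpoly K[n]} / J,
   the last clause is the identity (1 - X)^d * (\sum_i H i * X^i) = h of formal
   power series over the integers, read off coefficient by coefficient. *)
Definition h_polynomial_quot (K : fieldType) (n : nat)
    (J : idealr {mpoly K[n]}) (h : {poly int}) : Prop :=
  exists (d : nat) (H : nat -> nat),
    [/\ krull_dim {ideal_quot J} d,
        forall i, graded_dim J i (H i) &
        forall i, h`_i = \sum_(j < i.+1) ((1 - 'X) ^+ d)`_j * (H (i - j)%N)%:Z].

Section BinomialEdgeIdeal.
Variables (K : fieldType) (G : sgraph).

(* The vertices are numbered by enum_val : 'I_#|G| -> G; the first #|G| variables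
   are the x_i and the last #|G| ones are the y_i. *)
Definition edge_binomial (i j : 'I_#|G|) : {mpoly K[#|G| + #|G|]} :=
  'X_(lshift #|G| i) * 'X_(rshift #|G| j) - 'X_(lshift #|G| j) * 'X_(rshift #|G| i).

Definition edge_index (e : 'I_#|G| * 'I_#|G|) : bool :=
  (e.1 < e.2)%N && adj (enum_val e.1) (enum_val e.2).

Definition binomial_edge_ideal : {pred {mpoly K[#|G| + #|G|]}} :=
  fun p => `[< exists q : 'I_#|G| * 'I_#|G| -> {mpoly K[#|G| + #|G|]},
                 p = \sum_(e | edge_index e) q e * edge_binomial e.1 e.2 >].

Lemma binomial_edge_ideal_closed : idealr_closed binomial_edge_ideal.
Proof.
split.
- apply/asboolP; exists (fun=> 0).
  by rewrite big1 // => e _; rewrite mul0r.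
- apply/asboolP => -[q /(congr1 (meval (fun=> 0)))].
  rewrite rmorph1 raddf_sum big1 => [/eqP|e _]; first by rewrite oner_eq0.
  by rewrite /= mevalM mevalB !mevalM !mevalXU !mul0r subrr mulr0.
move=> a u v /asboolP[q ->] /asboolP[s ->]; apply/asboolP.
exists (fun e => a * q e + s e); rewrite mulr_sumr -big_split.
by apply: eq_bigr => e _; rewrite mulrDl mulrA.
Qed.

HB.instance Definition _ :=
  isIdealr.Build _ binomial_edge_ideal binomial_edge_ideal_closed.

Definition h_polynomial (h : {poly int}) : Prop :=
  h_polynomial_quot binomial_edge_ideal h.

End BinomialEdgeIdeal.

End HPolynomial.

(* Main.v *)
Require Import Defs.
From HB Require Import structures.
From mathcomp Require Import all_boot all_order all_algebra mpoly.
From mathcomp Require Import boolp classical_sets set_interval reals.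
From mathcomp Require Import topology normedtype sequences.
From mathcomp Require Import zify ring lra.

(** Let n = m + t.  Modulo the edge ideal of G_t = P_m * K_t, two monomials with the
    same multidegree and the same x-degree agree as soon as they involve a vertex
    of K_t; hence in degree i the quotient has dimension (i+1) C(i+n-1, i), as for
    the complete graph on n vertices, plus a number delta_i that depends only on
    P_m: the codimension in degree i of the edge ideal of P_m in that of K_m.  It
    is not zero for i = 2, because m >= 3.  Comparing with t = 1, the series of
    delta is g / (1 - X)^E for a fixed polynomial g <> 0, so that
    (1 - X)^(n+1) h_t = (1 - X)^(d_t) B with
    B = 1 + (n - 1) X + (1 - X)^(n+1-E) g.  For large t this B does not vanish at 1,
    which forces deg h_t >= deg B = n + 1 - E + deg g, without computing the Krull
    dimension d_t.  On the other hand a maximal clique of G_t contains K_t, so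
    their number is bounded independently of t. *)

Set Implicit Arguments.
Unset Strict Implicit.
Unset Printing Implicit Defensive.

Import Order.TTheory GRing.Theory Num.Theory.
Import numFieldNormedType.Exports.

Local Open Scope ring_scope.

(** * Series with denominator a power of 1 - X *)

Section PolyAction.

(* The product of a polynomial and a formal power series, the latter being given
   by its sequence of coefficients. *)
Definition pact (p : {poly int}) (a : nat -> int) (i : nat) : int :=
  \sum_(j < i.+1) p`_j * a (i - j)%N.

Lemma eq_pact p a b : a =1 b -> pact p a =1 pact p b.
Proof. by move=> ab i; apply: eq_bigr => j _; rewrite ab. Qed.

Lemma pact_trunc N p a i : (i < N)%N -> pact p a i = (p * \poly_(k < N) a k)`_i.
Proof.
move=> iN; rewrite coefM; apply: eq_bigr => j _.
by rewrite coef_poly (leq_ltn_trans (leq_subr _ _) iN).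
Qed.

(** A coefficient depends on finitely many terms only, so after truncation this is associativity in
    the polynomial ring. *)
Lemma pactM p q a : pact (p * q) a =1 pact p (pact q a).
Proof.
move=> i; rewrite (@pact_trunc i.+1) // -mulrA coefM; apply: eq_bigr => j _.
by rewrite (@pact_trunc i.+1) // ltnS leq_subr.
Qed.

Lemma pactD p a b i : pact p (fun k => a k + b k) i = pact p a i + pact p b i.
Proof. by rewrite -big_split; apply: eq_bigr => j _; rewrite mulrDr. Qed.

Lemma pact_poly p (q : {poly int}) : pact p (fun i => q`_i) =1 (fun i => (p * q)`_i).
Proof. by move=> i; rewrite coefM. Qed.

Lemma pact_1subX a i : pact (1 - 'X) a i = a i - (if i is k.+1 then a k else 0).
Proof.
rewrite /pact big_ord_recl subn0 coefB coef1 coefX subr0 mul1r; congr (_ + _).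
case: i => [|i]; first by rewrite big_ord0 oppr0.
rewrite big_ord_recl coefB coef1 coefX sub0r mulN1r subSS subn0 big1 ?addr0 //.
by move=> j _; rewrite coefB coef1 coefX subr0 mul0r.
Qed.

(** A polynomial with constant term 1 is invertible as a power series; strong induction on the index
    replaces the inverse. *)
Lemma pact_eq0 (p : {poly int}) a : p`_0 = 1 -> pact p a =1 (fun=> 0) -> a =1 (fun=> 0).
Proof.
move=> p0 pa i; elim/ltn_ind: i => i IH; have := pa i.
rewrite /pact big_ord_recl subn0 p0 mul1r big1 ?addr0 // => j _.
by rewrite IH ?mulr0 // lift0; have := ltn_ord j; lia.
Qed.

(** Each further factor 1 - X is Pascal's rule. *)
Lemma pact_binomial n : pact ((1 - 'X) ^+ n.+1) (fun i => 'C(i + n, i)%:Z) =1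
  (fun i => (1 : {poly int})`_i).
Proof.
elim: n => [|n IHn] i; last rewrite exprSr pactM.
  rewrite expr1 pact_1subX coef1; case: i => [|i]; first by rewrite bin0 subr0.
  by rewrite !addn0 !binn subrr.
rewrite -(IHn i); apply: eq_pact => {}i.
rewrite pact_1subX; case: i => [|i]; first by rewrite !bin0 subr0.
by rewrite addSn binS !addnS addSn PoszD addrK.
Qed.

(* The Hilbert series of a complete graph: the sequence is the Hilbert function
   of the Segre product of P^1 and P^n. *)
Lemma pact_segre n :
  pact ((1 - 'X) ^+ n.+2) (fun i => (i.+1 * 'C(i + n, i))%N%:Z) =1
  (fun i => (1 + n%:Z *: 'X)`_i).
Proof.
move=> i.
(* Since [i * C(i + n, i) = (n + 1) * C(i + n, i - 1)], the series is [1 / (1 - X)^(n+1) + (n + 1) X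
   / (1 - X)^(n+2)]. *)
transitivity (pact ((1 - 'X) ^+ n.+2) (fun i => 'C(i + n, i)%:Z +
   pact ((n.+1)%:Z *: 'X) (fun i => 'C(i + n.+1, i)%:Z) i) i).
  apply: eq_pact => {}i; rewrite mulSn PoszD; congr (_ + _).
  case: i => [|i].
    by rewrite mul0n /pact big_ord1 coefZ coefX mulr0 mul0r.
  rewrite /pact big_ord_recl coefZ coefX mulr0 mul0r add0r.
  rewrite big_ord_recl coefZ coefX mulr1 subSS subn0 big1 ?addr0; last first.
    by move=> j _; rewrite coefZ coefX mulr0 mul0r.
  rewrite -PoszM; congr Posz.
  have := mul_bin_left (i.+1 + n) i.
  by rewrite (_ : i.+1 + n - i = n.+1)%N; [rewrite addSnnS; move->|lia].
rewrite pactD -pactM mulrC pactM exprS pactM.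
rewrite (eq_pact _ (pact_binomial n)) -exprS.
rewrite (eq_pact _ (pact_binomial n.+1)) !pact_poly !mulr1.
rewrite -coefD; congr (_ `_ _); rewrite -addn1 PoszD scalerDl scale1r.
by rewrite [_ + 'X]addrC addrA subrK.
Qed.

End PolyAction.

Lemma size_1subX_exp n : size ((1 - 'X : {poly int}) ^+ n) = n.+1.
Proof.
have -> : (1 - 'X : {poly int}) = (-1)%:P * ('X - 1%:P).
  by rewrite polyCN mulN1r opprB.
rewrite exprMn -polyC_exp mul_polyC size_scale ?size_exp_XsubC //.
by rewrite expf_neq0.
Qed.

(* Since 1 + (m + t) X does not vanish at 1, the power of 1 - X in the denominator
   of the series cannot drop below m + t + 2, whatever the exponent d t is. *)
Lemma h_degree_unbounded (m : nat) (delta : nat -> int) (h : nat -> {poly int})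
    (d : nat -> nat) i0 :
    delta i0 != 0 ->
    (forall t i, (1 <= t)%N -> (h t)`_i = pact ((1 - 'X) ^+ d t)
       (fun k => (k.+1 * 'C(k + (m + t), k))%N%:Z + delta k) i) ->
  exists c, forall t, (1 <= t)%N -> (t <= (size (h t)).-1 + c)%N.
Proof.
move=> delta0 hE; pose Y : {poly int} := 1 - 'X.
have Y1 : Y.[1] = 0 by rewrite !hornerE subrr.
have YN0 n : Y ^+ n != 0 by rewrite -size_poly_gt0 size_1subX_exp.
(* The relation for [h t], solved for the [delta] term: a power of [Y] turns [delta] into a
   polynomial. *)
have key t : (1 <= t)%N -> pact (Y ^+ (m + t).+2 * Y ^+ d t) delta =1
    (fun i => (Y ^+ (m + t).+2 * h t - Y ^+ d t * (1 + (m + t)%:Z *: 'X))`_i).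
  move=> t1 i; rewrite coefB -pact_poly (eq_pact _ (hE t ^~ t1)) -pactM.
  rewrite pactD mulrC [X in X + _ - _](_ : _ = (Y ^+ d t * (1 + (m + t)%:Z *: 'X))`_i).
    by rewrite addrAC subrr add0r.
  by rewrite pactM (eq_pact _ (pact_segre _)) pact_poly.
(* The case t = 1 provides an exponent and a polynomial that serve for all t. *)
pose E := ((m + 1).+2 + d 1%N)%N.
pose g := Y ^+ (m + 1).+2 * h 1%N - Y ^+ d 1%N * (1 + (m + 1)%N%:Z *: 'X).
have gE : pact (Y ^+ E) delta =1 (fun i => g`_i).
  by move=> i; rewrite exprD key.
have g0 : g != 0.
  apply: contra delta0 => /eqP g0; apply/eqP.
  apply: (@pact_eq0 (Y ^+ E)) => [|i]; last by rewrite gE g0 coef0.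
  by rewrite -horner_coef0 !hornerE expr1n.
(* For t > E + 2 the exponent [n] below exceeds 2, so [Y ^+ n * g] vanishes at 1 and outgrows the
   linear part of [B]; for smaller t the bound is trivial. *)
exists (E + 2)%N => t t1; case: (leqP t (E + 2)) => [tE|Et].
  exact: leq_trans tE (leq_addl _ _).
pose n := ((m + t).+2 - E)%N; have nE : (m + t).+2 = (n + E)%N by rewrite /n; lia.
pose B := 1 + (m + t)%:Z *: 'X + Y ^+ n * g.
have hB : Y ^+ (m + t).+2 * h t = Y ^+ d t * B.
  apply/eqP; rewrite /B mulrDr addrC -subr_eq; apply/eqP/polyP => i.
  rewrite -key // mulrA -pact_poly -(eq_pact _ gE) -pactM.
  by congr (pact _ _ _); rewrite nE exprD; ring.
have B1 : B.[1] != 0.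
  have -> : B.[1] = (1 + (m + t)%:Z *: 'X : {poly int}).[1] + Y.[1] ^+ n * g.[1].
    by rewrite -horner_exp -hornerM -hornerD.
  rewrite Y1 expr0n (_ : (n == 0)%N = false); last by rewrite /n; lia.
  by rewrite mul0r addr0 !hornerE; lia.
(* Otherwise cancelling [Y ^+ d t] would leave a factor [Y] in [B], against [B1]. *)
have dn : ((m + t).+2 <= d t)%N.
  rewrite leqNgt; apply/negP => dlt.
  have e : (m + t).+2 = (d t + ((m + t).+2 - d t).-1.+1)%N by lia.
  move: hB; rewrite e exprD -mulrA => /(mulfI (YN0 _)) hB.
  by move: B1; rewrite -hB hornerM horner_exp Y1 expr0n mul0r eqxx.
move: hB; rewrite -(subnKC dn) exprD -mulrA => /(mulfI (YN0 _)) ->.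
have B0 : B != 0 by apply: contraNneq B1 => ->; rewrite horner0.
rewrite size_mul ?YN0 // size_1subX_exp.
have sg : (0 < size g)%N by rewrite size_poly_gt0.
have n2 : (2 < n)%N by move: nE Et; move: (n) (E); clear; lia.
suff : (n + size g <= size B)%N.
  move: sg n2 (leq_addl m t) nE dn; move: (size B) (size g) (d t) (n) (E) (m + t)%N.
  clear; lia.
have szYg : size (Y ^+ n * g) = (n + size g)%N by rewrite size_mul ?YN0 // size_1subX_exp.
suff lt : (size (1 + (m + t)%:Z *: 'X : {poly int})%R < size (Y ^+ n * g)%R)%N.
  by rewrite -szYg /B addrC (size_polyDl lt).
rewrite szYg.
have sX := size_scale_leq (m + t)%N%:Z ('X : {poly int}); rewrite size_polyX in sX.
apply: leq_ltn_trans (size_polyD _ _) _; rewrite gtn_max size_poly1.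
rewrite (leq_ltn_trans sX); move: sg n2; move: (size g) (n); clear; lia.
Qed.

(** * Bases modulo a subspace *)

Section RelativeBases.
Variables (K : fieldType) (V : lmodType K) (J : V -> Prop).

(** Independence of classes modulo [J], stated in [V] itself so that no quotient space has to be
    formed. *)
Definition free_mod (I : finType) (b : I -> V) : Prop :=
  forall c : I -> K, J (\sum_j c j *: b j) -> forall j, c j = 0.

Definition span_mod (I : finType) (b : I -> V) (p : V) : Prop :=
  exists c : I -> K, J (p - \sum_j c j *: b j).

Hypotheses (J0 : J 0) (JP : forall a u v, J u -> J v -> J (a *: u + v)).

Lemma modD u v : J u -> J v -> J (u + v).
Proof. by move=> Ju Jv; rewrite -[u]scale1r; exact: JP. Qed.

Lemma modZ a u : J u -> J (a *: u).
Proof. by move=> Ju; rewrite -[_ *: _]addr0; exact: JP. Qed.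

Lemma mod_sum (I : Type) (r : seq I) (P : pred I) (F : I -> V) :
  (forall i, P i -> J (F i)) -> J (\sum_(i <- r | P i) F i).
Proof. by move=> JF; elim/big_ind: _ => //; exact: modD. Qed.

Lemma span_modP (I : finType) (b : I -> V) a u v :
  span_mod b u -> span_mod b v -> span_mod b (a *: u + v).
Proof.
move=> [c cJ] [c' cJ']; exists (fun j => a * c j + c' j).
have -> : a *: u + v - \sum_j (a * c j + c' j) *: b j =
    a *: (u - \sum_j c j *: b j) + (v - \sum_j c' j *: b j).
  rewrite scalerBr scaler_sumr addrACA -opprD -big_split; congr (_ - _).
  by apply: eq_bigr => j _; rewrite scalerDl scalerA.
exact: JP.
Qed.

Lemma span_mod0 (I : finType) (b : I -> V) u : J u -> span_mod b u.
Proof.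
by move=> Ju; exists (fun=> 0); rewrite big1 ?subr0 // => j _; rewrite scale0r.
Qed.

Lemma span_mod_sum (I : finType) (b : I -> V) (T : Type) (r : seq T)
    (P : pred T) (F : T -> V) :
  (forall i, P i -> span_mod b (F i)) -> span_mod b (\sum_(i <- r | P i) F i).
Proof.
move=> sF; elim/big_ind: _ => //; first exact: span_mod0.
by move=> u v su sv; rewrite -[u]scale1r; apply: span_modP.
Qed.

(** Steinitz: with more rows than columns, the matrix expressing [b] through [b'] modulo [J] has a
    nonzero vector in its left kernel, which is a forbidden relation on [b]. *)
Lemma free_mod_card_le (I I' : finType) (b : I -> V) (b' : I' -> V) :
  free_mod b -> (forall j, span_mod b' (b j)) -> (#|I| <= #|I'|)%N.
Proof.
move=> fb /choice[M MP]; rewrite leqNgt; apply/negP => lt.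
pose A : 'M[K]_(#|I|, #|I'|) := \matrix_(i, j) M (enum_val i) (enum_val j).
have /rowV0Pn[v /sub_kermxP vA v0] : kermx A != 0.
  rewrite -mxrank_eq0 mxrank_ker subn_eq0 -ltnNge.
  exact: leq_ltn_trans (rank_leq_col _) lt.
case/negP: v0; apply/eqP/rowP => i; rewrite mxE -[i]enum_valK.
apply: (fb (fun j => v 0 (enum_rank j))).
have -> : \sum_j v 0 (enum_rank j) *: b j =
    \sum_j v 0 (enum_rank j) *: (b j - \sum_k M j k *: b' k).
  rewrite (eq_bigr _ (fun j _ => scalerBr _ _ _)) sumrB -[LHS]subr0; congr (_ - _).
  rewrite (eq_bigr _ (fun j _ => scaler_sumr _ _ _ _)) exchange_big big1 // => k _.
  rewrite (eq_bigr _ (fun j _ => scalerA _ _ _)) -scaler_suml.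
  suff -> : \sum_j v 0 (enum_rank j) * M j k = (v *m A) 0 (enum_rank k).
    by rewrite vA mxE scale0r.
  rewrite mxE [RHS](reindex enum_rank) /=;
    last by apply: onW_bij; exact: enum_rank_bij.
  by apply: eq_bigr => j _; rewrite mxE !enum_rankK.
by apply: mod_sum => j _; apply: modZ.
Qed.

(** Take a free family in [A] of maximal size, sizes being bounded by that of [b']; adjoining any
    [p] of [A] creates a relation, which can be solved for [p]. *)
Lemma exists_basis_mod (A : V -> Prop) (I' : finType) (b' : I' -> V) :
    (forall p, A p -> span_mod b' p) ->
  exists N (b : 'I_N -> V),
    [/\ forall j, A (b j), free_mod b & forall p, A p -> span_mod b p].
Proof.
move=> sA.
pose P N := `[< exists b : 'I_N -> V, (forall j, A (b j)) /\ free_mod b >].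
have P0 : exists N, P N.
  exists 0%N; apply/asboolP; exists (fun=> 0).
  by split=> [[]|c _ []].
have Pmax N : P N -> (N <= #|I'|)%N.
  move=> /asboolP[b [bA bf]]; rewrite -[N]card_ord.
  by apply: free_mod_card_le bf _ => j; apply: sA.
case: (ex_maxnP P0 Pmax) => N /asboolP[b [bA bf]] max; exists N, b; split=> // p Ap.
pose b1 (j : 'I_N.+1) := if unlift ord_max j is Some k then b k else p.
have : ~ free_mod b1.
  move=> fb1; have := max N.+1; rewrite ltnn => /(_ _)/notF; apply.
  by apply/asboolP; exists b1; split=> // j; rewrite /b1; case: unliftP.
have b1E c : \sum_j c j *: b1 j = \sum_j c (lift ord_max j) *: b j + c ord_max *: p.
  rewrite big_ord_recr /= /b1 unlift_none; congr (_ + _); apply: eq_bigr => j _.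
  have -> : widen_ord (leqnSn N) j = lift ord_max j.
    exact/esym/val_inj/lift_max.
  by rewrite liftK.
move=> /existsNP[c] /not_implyP[Jc] /existsNP[j0 cj0].
rewrite b1E in Jc; have [c0|cN0] := eqVneq (c ord_max) 0.
  case: cj0; rewrite c0 scale0r addr0 in Jc.
  by case: (unliftP ord_max j0) => [k ->|->//]; apply: bf Jc k.
exists (fun j => - (c ord_max)^-1 * c (lift ord_max j)).
have -> : p - \sum_j (- (c ord_max)^-1 * c (lift ord_max j)) *: b j =
   (c ord_max)^-1 *: (\sum_j c (lift ord_max j) *: b j + c ord_max *: p).
  rewrite scalerDr scalerA mulVf // scale1r addrC; congr (_ + _).
  rewrite scaler_sumr -sumrN; apply: eq_bigr => j _.
  by rewrite scalerA mulNr scaleNr opprK.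
exact: modZ.
Qed.

End RelativeBases.

(** * Joins of paths and complete graphs *)

Lemma giso_card (G H : sgraph) : giso G H -> #|G| = #|H|.
Proof. by case=> f /bij_eq_card. Qed.

Lemma giso_trans (G H L : sgraph) : giso G H -> giso H L -> giso G L.
Proof.
move=> [f fb fa] [g gb ga]; exists (g \o f); first exact: bij_comp.
by move=> x y; rewrite /= ga fa.
Qed.

Lemma component_giso (G : sgraph) (v : G) :
  (forall u, connect (@adj G) v u) -> giso (component v) G.
Proof.
move=> cv; exists val => //; exists (fun u => exist _ u (cv u)) => // x.
exact: val_inj.
Qed.

Lemma card_join (G H : sgraph) : #|join G H| = (#|G| + #|H|)%N.
Proof. exact: card_sum. Qed.

Lemma join_complete_connect (H : sgraph) t (u v : join H (complete_graph t)) :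
  (1 <= t)%N -> connect (@adj _) u v.
Proof.
move=> t1; pose w : join H (complete_graph t) := inr (Ordinal t1).
have cw x : connect (@adj _) x w.
  have [->|xw] := eqVneq x w; first exact: connect0.
  by apply: connect1; case: x xw.
apply: connect_trans (cw u) _.
by rewrite (sym_connect_sym (@adj_sym _)).
Qed.

(** A maximal clique contains every vertex of the complete graph, hence is determined by its trace
    on [H]. *)
Lemma nb_maximal_cliques_join (H : sgraph) t :
  (nb_maximal_cliques (join H (complete_graph t)) <= 2 ^ #|H|)%N.
Proof.
set G := join _ _; pose f (A : {set G}) : {set H} := [set x | inl x \in A].
rewrite -[#|H|]cardsT -card_powerset /nb_maximal_cliques.
rewrite -(@card_in_imset _ _ f)  => [|A B].
  by apply: subset_leq_card; apply/fintype.subsetP => B _; rewrite inE finset.subsetT.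
have univ (C : {set G}) : C \in [set C | maxset (@clique G) C] -> forall x, inr x \in C.
  rewrite inE => /maxsetP[/'forall_in_forall_inP CC Cmax] x.
  suff <- : inr x |: C = C by rewrite !inE eqxx.
  apply: Cmax; last exact: finset.subsetUr.
  apply/'forall_in_forall_inP => y; rewrite !inE => yC z; rewrite !inE => zC.
  apply/implyP => yz; case/orP: yC => [/eqP yx|yC].
    by subst y; case: z zC yz.
  case/orP: zC => [/eqP zx|zC]; last exact: (implyP (CC _ yC _ zC)).
  by subst z; case: y yC yz.
move=> /univ uA /univ uB /finset.setP fAB; apply/finset.setP => -[x|x];
  last by rewrite uA uB.
by have := fAB x; rewrite !inE.
Qed.

(** * Interval representation of the join, and a criterion for the limits *)

Section Intervals.
Local Open Scope classical_set_scope.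
Variable R : realType.

Lemma itv_meet (a b c d : R) : a <= b -> c <= d ->
  `[< [set` `[a, b]] `&` [set` `[c, d]] !=set0 >] = (a <= d) && (c <= b).
Proof.
rewrite !set_mem_set !set_itvE => ab cd; apply/asboolP/andP => [[x [abx cdx]]|[ad cb]].
  have /andP[ax xb] : a <= x <= b := abx.
  have /andP[cx xd] : c <= x <= d := cdx.
  by split; [exact: le_trans ax xd|exact: le_trans cx xb].
exists (Num.max a c); split; rewrite /mkset.
  by rewrite le_max lexx ge_max ab cb.
by rewrite le_max lexx orbT ge_max ad cd.
Qed.

(** The path is carried by J_0, ..., J_k, and all vertices of K_t get the interval [0, k - 1]: it
    meets every J_i, the last one in k - 1, and avoids k. *)
Lemma join_path_complete_interval k t : (2 <= k)%N ->
  connected_strongly_interval R (join (path_graph k.+1) (complete_graph t)).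
Proof.
move=> k2; exists k, t, (fun=> 0), (fun=> (k.-1)%:R); split=> //.
- exact: ltnW.
- by exists 0%N.
- move=> _ x; rewrite !set_mem_set !set_itvE => xI.
  have /andP[x0 xk] : 0 <= x <= k.-1%:R := xI.
  have xk' : x < k%:R by rewrite (le_lt_trans xk) // ltr_nat prednK // ltnW.
  split; first by apply/andP; rewrite x0 ltW.
  by move=> xE; rewrite xE ltxx in xk'.
exists id; first by exists id.
have lep (i : 'I_k.+1) : (i.-1)%:R <= i%:R :> R by rewrite ler_nat leq_pred.
case=> [i|i] [j|j]; rewrite /= /interval_adj /=.
- rewrite itv_meet // !ler_nat /path_adj.
  rewrite -[inl i != inl j]/(nat_of_ord i != nat_of_ord j); have := ltn_ord i; lia.
- rewrite itv_meet // ?ler0n // ler_nat andbT.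
  by have := ltn_ord i; lia.
- rewrite itv_meet // ?ler0n // ler_nat /=.
  by have := ltn_ord j; lia.
- by rewrite itv_meet ?ler0n // !andbT -[LHS]/(i != j).
Qed.

Lemma strongly_interval_join_path m t : (3 <= m)%N -> (1 <= t)%N ->
  strongly_interval R (join (path_graph m) (complete_graph t)).
Proof.
case: m => // k k2 t1 v.
have [k' [r [a [b [h1 h2 h3 h4 h5]]]]] := join_path_complete_interval t k2.
exists k', r, a, b; split=> //; apply: giso_trans h5.
by apply: component_giso => u; exact: join_complete_connect.
Qed.

Lemma cvg_bounded_ratio (N : nat -> nat) (D : nat -> R) (M c : nat) :
    (forall t, (N t <= M)%N) -> (forall t, (1 <= t)%N -> t%:R - c%:R <= D t) ->
  (fun t => (N t)%:R / D t) @ \oo --> (0 : R).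
Proof.
move=> NM Dc; apply/cvgrPdist_lt => eps eps0; near=> t.
(* Beyond this threshold the denominator exceeds [M / eps]. *)
have tc : c%:R + M%:R / eps < t%:R :> R by near: t; exact: nbhs_infty_gtr.
have t1 : (1 <= t)%N by near: t; exact: nbhs_infty_ge.
have Me : 0 <= M%:R / eps :> R by rewrite divr_ge0 ?ler0n // ltW.
have D0 : M%:R / eps < D t by have := Dc t t1; lra.
have Dp : 0 < D t by exact: le_lt_trans D0.
rewrite sub0r normrN ger0_norm ?divr_ge0 ?ler0n ?(ltW Dp) //.
rewrite ltr_pdivrMr // mulrC; rewrite ltr_pdivrMr // in D0.
by apply: le_lt_trans D0; rewrite ler_nat.
Unshelve. all: by end_near.
Qed.

End Intervals.

(** * Binomial edge ideals *)

Local Notation xvar i := 'X_(lshift _ i).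
Local Notation yvar i := 'X_(rshift _ i).
Local Notation minor2 i j := (xvar i * yvar j - xvar j * yvar i).
Local Notation neq := (fun i j => i != j).

(** * Multidegree and x-degree of monomials *)

Section MonomialData.
Variable n : nat.
Implicit Types (m : 'X_{1..n + n}) (a : 'X_{1..n}).

(** Together with [xdeg] this is a grading for which all 2-minors are homogeneous: x_i y_j and x_j
    y_i agree in both. *)
Definition multideg m : 'X_{1..n} :=
  [multinom (m (lshift n i) + m (rshift n i))%N | i < n].

Definition xdeg m : nat := (\sum_(i < n) m (lshift n i))%N.

Lemma mdeg_multideg m : mdeg (multideg m) = mdeg m.
Proof.
rewrite !mdegE big_split_ord /= -big_split.
by apply: eq_bigr => i _; rewrite mnmE.
Qed.

Lemma xdeg_le m : (xdeg m <= mdeg m)%N.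
Proof. by rewrite mdegE big_split_ord leq_addr. Qed.

(** Start from the pure y-monomial and turn one y_i into x_i at a time; some y_i is left as long as
    the x-degree is below the total degree. *)
Lemma exists_monomial a p :
  (p <= mdeg a)%N -> exists m, multideg m = a /\ xdeg m = p.
Proof.
elim: p => [_|p IHp pa].
  exists [multinom (if split k is inr i then a i else 0%N) | k < n + n]; split.
    apply/mnmP => i; rewrite mnmE !mnmE.
    by rewrite (unsplitK (inl i)) (unsplitK (inr i)).
  by rewrite /xdeg big1 // => i _; rewrite mnmE (unsplitK (inl i)).
have [m [ma mp]] := IHp (ltnW pa).
have [i mi] : exists i, (0 < m (rshift n i))%N.
  apply/existsP; apply: contraLR pa; rewrite negb_exists => /forallP m0.
  rewrite -leqNgt -mp -ma mdeg_multideg mdegE big_split_ord /= -[X in (_ <= X)%N]addn0.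
  rewrite leq_add2l big1 // => i _; apply/eqP.
  by move: (m0 i); rewrite -eqn0Ngt.
exists (m - U_(rshift n i) + U_(lshift n i))%MM; split.
  apply/mnmP => j; move/mnmP/(_ j): ma; rewrite !mnmE !eq_lshift !eq_rshift.
  rewrite eq_lrshift eq_rlshift; case: (eqVneq i j) => [<-|_]; last lia.
  by move=> <-; lia.
rewrite /xdeg -mp /xdeg (bigD1 i) //= [in RHS](bigD1 i) //= !mnmE eqxx eq_rlshift.
rewrite subn0 addn1 addSn; congr (_ + _).+1; apply: eq_bigr => j ji.
by rewrite !mnmE eq_rlshift eq_lshift eq_sym (negPf ji) subn0 addn0.
Qed.

End MonomialData.

(** * Edge ideals of relations, evaluations, exchanges in monomials *)

Section EdgeIdeal.
Variable K : fieldType.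

(** With a relation in place of a graph, [neq] gives the ideal of all 2-minors, the edge ideal of a
    complete graph. *)
Definition edge_ideal n (a : rel 'I_n) (p : {mpoly K[n + n]}) : Prop :=
  exists q : 'I_n * 'I_n -> {mpoly K[n + n]},
    p = \sum_(e : 'I_n * 'I_n | (e.1 < e.2)%N && a e.1 e.2) q e * minor2 e.1 e.2.

Section Ideal.
Variables (n : nat) (a : rel 'I_n).
Implicit Types (p q : {mpoly K[n + n]}).

Lemma edge_idealD p q : edge_ideal a p -> edge_ideal a q -> edge_ideal a (p + q).
Proof.
move=> [u ->] [v ->]; exists (fun e => u e + v e); rewrite -big_split.
by apply: eq_bigr => e _; rewrite mulrDl.
Qed.

Lemma edge_idealM p q : edge_ideal a q -> edge_ideal a (p * q).
Proof.
move=> [v ->]; exists (fun e => p * v e); rewrite mulr_sumr.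
by apply: eq_bigr => e _; rewrite mulrA.
Qed.

Lemma edge_ideal0 : edge_ideal a 0.
Proof. by exists (fun=> 0); rewrite big1 // => e _; rewrite mul0r. Qed.

Lemma edge_idealN p : edge_ideal a p -> edge_ideal a (- p).
Proof. by rewrite -mulN1r; exact: edge_idealM. Qed.

Lemma edge_idealP (c : K) p q :
  edge_ideal a p -> edge_ideal a q -> edge_ideal a (c *: p + q).
Proof. by rewrite -mul_mpolyC => Jp; apply/edge_idealD/edge_idealM. Qed.

Lemma edge_ideal_minor i j : ssrbool.symmetric a -> i != j -> a i j ->
  edge_ideal a (minor2 i j).
Proof.
move=> asym; wlog ij : i j / (i < j)%N => [hw ij aij|_ aij].
  move: (ij); rewrite neq_ltn => /orP[|] lt; first exact: hw.
  by rewrite -opprB; apply/edge_idealN/hw; rewrite 1?eq_sym // asym.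
exists (fun e => (e == (i, j))%:R); rewrite (bigD1 (i, j)) ?ij //= eqxx mul1r.
by rewrite big1 ?addr0 // => e /andP[_ /negPf->]; rewrite mul0r.
Qed.

End Ideal.

Section Evaluation.
Variables (T : comNzRingType) (f : {rmorphism K -> T}) (n : nat) (u v : 'I_n -> T).

(** Specialised below to the Segre map, to maps between two vertex sets, and to a point over [K]. *)
Definition xyeval : {mpoly K[n + n]} -> T :=
  mmap f (fun k => match split k with inl i => u i | inr i => v i end).

HB.instance Definition _ := GRing.RMorphism.on xyeval.

Lemma xyeval_x i : xyeval (xvar i) = u i.
Proof. by rewrite /xyeval mmapX mmap1U (unsplitK (inl i)). Qed.

Lemma xyeval_y i : xyeval (yvar i) = v i.
Proof. by rewrite /xyeval mmapX mmap1U (unsplitK (inr i)). Qed.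

Lemma xyevalZ c p : xyeval (c *: p) = f c * xyeval p.
Proof. exact: mmapZ. Qed.

Lemma xyeval_minor i j : xyeval (minor2 i j) = u i * v j - u j * v i.
Proof. by rewrite rmorphB !rmorphM /= !xyeval_x !xyeval_y. Qed.

Lemma xyeval_edge_ideal0 (a : rel 'I_n) p :
  (forall i j, a i j -> u i * v j = u j * v i) -> edge_ideal a p -> xyeval p = 0.
Proof.
move=> uv [q ->]; rewrite rmorph_sum big1 // => e /andP[_ ae].
by rewrite rmorphM /= xyeval_minor uv // subrr mulr0.
Qed.

End Evaluation.

Lemma xyeval_edge_ideal n n' (u v : 'I_n -> {mpoly K[n' + n']})
    (a : rel 'I_n) (b : rel 'I_n') p :
    (forall i j, a i j -> edge_ideal b (u i * v j - u j * v i)) ->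
  edge_ideal a p -> edge_ideal b (xyeval (@mpolyC _ K) u v p).
Proof.
move=> uv [q ->]; rewrite rmorph_sum; elim/big_ind: _ => [||e /andP[_ ae]].
- exact: edge_ideal0.
- by move=> ? ?; exact: edge_idealD.
- by rewrite rmorphM /= xyeval_minor; apply/edge_idealM/uv.
Qed.

Lemma xyeval_homog n n' (u v : 'I_n -> {mpoly K[n' + n']}) d p :
    (forall i, u i \is 1.-homog) -> (forall i, v i \is 1.-homog) ->
  p \is d.-homog -> xyeval (@mpolyC _ K) u v p \is d.-homog.
Proof.
move=> uh vh /dhomogP ph; rewrite /xyeval /mmap big_seq; apply: rpred_sum => m /ph /= <-.
rewrite mul_mpolyC; apply: rpredZ; rewrite /mmap1 mdegE.
elim/big_rec2: _ => [|k e q _ IH]; first exact: dhomog1.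
apply: dhomogM => //; rewrite -[X in X.-homog]mul1n; apply: dhomogMn.
by case: (split k).
Qed.

Lemma mpoly_rmorph_eq n (T : comNzRingType) (f g : {rmorphism {mpoly K[n]} -> T}) :
  (forall c, f c%:MP = g c%:MP) -> (forall i, f 'X_i = g 'X_i) -> f =1 g.
Proof.
move=> fgC fgX p; rewrite [p]mpolyE !rmorph_sum; apply: eq_bigr => m _ /=.
rewrite -mul_mpolyC !rmorphM fgC mpolyXE_id !rmorph_prod; congr (_ * _).
by apply: eq_bigr => i _; rewrite !rmorphXn /= fgX.
Qed.

Section Swap.
(** The exchange argument is used twice: for the edge ideal of the larger graph, [Q] saying that a
    given universal vertex occurs, and for the preimage under [retr] of the ideal of all 2-minors,
    with [Q] always true. *)
Variables (n : nat) (J : {mpoly K[n + n]} -> Prop) (Q : 'X_{1..n} -> Prop).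
Hypotheses (J0 : J 0) (JD : forall p q, J p -> J q -> J (p + q)).
Hypothesis Jswap : forall m i j, i != j ->
  Q (multideg (m + U_(lshift n i) + U_(rshift n j))%MM) ->
  J ('X_[m] * minor2 i j).

(* Exchanging x_i y_j with x_j y_i, where x_i is in excess and x_j is lacking,
   decreases the total excess of the x-exponents of m over those of m'. *)
Lemma swap_monomials (m m' : 'X_{1..n + n}) :
  multideg m = multideg m' -> xdeg m = xdeg m' -> Q (multideg m) ->
  J ('X_[m] - 'X_[m']).
Proof.
have sum_eq (E E' : 'I_n -> nat) : (forall i, E i <= E' i)%N ->
    (\sum_i E i = \sum_i E' i)%N -> E =1 E'.
  move=> le eqs i; have := (leqif_sum (fun i (_ : xpredT i) => conj (le i) erefl)).2.
  by rewrite eqs eqxx => /esym/forallP/(_ i)/eqP.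
have [k] := ubnP (\sum_(i < n) (m (lshift n i) - m' (lshift n i)))%N.
elim: k m => // k IHk m exc mm' xx' Qm.
case: (boolP [forall i, m (lshift n i) <= m' (lshift n i)]%N) => [/forallP le|].
  have eq_l i : m (lshift n i) = m' (lshift n i) by exact: (sum_eq _ _ le xx').
  suff -> : m = m' by rewrite subrr.
  apply/mnmP => j; case: (splitP j) => i ji.
    by have -> : j = lshift n i by apply: val_inj.
  have -> : j = rshift n i by apply: val_inj.
  by move/mnmP/(_ i): mm'; rewrite !mnmE eq_l; lia.
rewrite negb_forall => /existsP[i]; rewrite -ltnNge => lti.
have [j ltj] : exists j, (m (lshift n j) < m' (lshift n j))%N.
  apply/existsP; apply: contraLR lti; rewrite negb_exists => /forallP ge.
  have {}ge j : (m' (lshift n j) <= m (lshift n j))%N by rewrite leqNgt ge.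
  by rewrite (sum_eq _ _ ge) ?ltnn.
have mj : (0 < m (rshift n j))%N by move/mnmP/(_ j): mm'; rewrite !mnmE; lia.
have ij : i != j by apply: contraTneq ltj => <-; rewrite -leqNgt ltnW.
have ji : (j == i) = false by rewrite eq_sym (negPf ij).
(* [m2] is m / (x_i y_j), a monomial by [lti] and [mj]; [m1] is m with x_i y_j exchanged for x_j
   y_i. *)
pose m2 := (m - U_(lshift n i) - U_(rshift n j))%MM.
pose m1 := (m2 + U_(lshift n j) + U_(rshift n i))%MM.
have mE : m = (m2 + U_(lshift n i) + U_(rshift n j))%MM.
  apply/mnmP => h; rewrite !mnmE.
  have [<-|_] := eqVneq (lshift n i) h; first by rewrite eq_rlshift; lia.
  by have [<-|_] := eqVneq (rshift n j) h; lia.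
have m1l h : m1 (lshift n h) = (m (lshift n h) - (i == h) + (j == h))%N.
  by rewrite /m1 /m2 !mnmE !eq_lshift !eq_rlshift subn0 addn0.
have m1m : multideg m1 = multideg m.
  apply/mnmP => h; rewrite mnmE [in RHS]mnmE m1l /m1 /m2 !mnmE !eq_rshift !eq_lrshift.
  have [<-|_] := eqVneq i h; first by rewrite ?eqxx ?ji; lia.
  by have [<-|_] := eqVneq j h; rewrite ?eqxx; lia.
have m1x : xdeg m1 = xdeg m.
  rewrite /xdeg (eq_bigr _ (fun h _ => m1l h)).
  rewrite (bigD1 i) //= (bigD1 j) ?ji //= [in RHS](bigD1 i) //=.
  rewrite [in RHS](bigD1 j) ?ji //= !eqxx (negPf ij) ?ji.
  rewrite (eq_bigr (fun h => m (lshift n h))); first by lia.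
  move=> h /andP[hi hj]; rewrite eq_sym (negPf hi) eq_sym (negPf hj); lia.
have -> : 'X_[m] - 'X_[m'] = 'X_[m2] * minor2 i j + ('X_[m1] - 'X_[m'])
  :> {mpoly K[n + n]}.
  rewrite [in LHS]mE /m1 !mpolyXD; ring.
apply: JD; first by apply: Jswap; rewrite // -mE.
apply: IHk; rewrite ?m1m ?m1x //; rewrite ltnS in exc; apply: leq_trans exc.
rewrite (bigD1 i) //= [in ltnRHS](bigD1 i) //= m1l eqxx ji.
rewrite addn0 -addSn leq_add //; first by lia.
apply: leq_sum => h hi; rewrite m1l eq_sym (negPf hi).
have [<-|_] := eqVneq j h; lia.
Qed.
End Swap.

End EdgeIdeal.

(** * The Segre parametrisation *)

Section Segre.
Variables (K : fieldType) (n : nat).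

(* The parametrisation of the 2 x n matrices of rank at most 1, with the second
   parameter of the first factor set to 1. *)
Definition segre : {mpoly K[n + n]} -> {poly {mpoly K[n]}} :=
  xyeval (polyC \o @mpolyC n K) (fun i => ('X_i)%:P * 'X) (fun i => ('X_i)%:P).

HB.instance Definition _ := GRing.RMorphism.on segre.

(** The image records exactly the multidegree and the x-degree, so monomials with distinct such
    pairs are independent modulo the 2-minors. *)
Lemma segreX m : segre 'X_[m] = ('X_[multideg m])%:P * 'X^(xdeg m).
Proof.
rewrite /segre /xyeval mmapX /mmap1 big_split_ord /=.
under eq_bigr do rewrite (unsplitK (inl _)) exprMn.
under [X in _ * X]eq_bigr do rewrite (unsplitK (inr _)).
rewrite big_split prodrXr mulrAC; congr (_ * _).
rewrite -big_split mpolyXE_id rmorph_prod; apply: eq_bigr => i _.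
by rewrite mnmE exprD rmorphM !rmorphXn.
Qed.

Lemma segreZ c p : segre (c *: p) = c%:MP%:P * segre p.
Proof. exact: xyevalZ. Qed.

Lemma segre_edge_ideal a p : edge_ideal a p -> segre p = 0.
Proof.
have swap (T : comNzRingType) (x y z : T) : x * z * y = y * z * x.
  by rewrite mulrC [x * z]mulrC mulrA.
by apply: xyeval_edge_ideal0 => i j _; exact: swap.
Qed.

End Segre.

Lemma homog_span (K : fieldType) n d (p : {mpoly K[n]}) :
  p \is d.-homog ->
  exists c : 'X_{1..n < d.+1} -> K, p = \sum_m c m *: 'X_[m].
Proof.
move=> ph; exists (fun m => p@_m); apply: mpolywE; rewrite msizeE.
by apply/bigmax_leqP_seq => m mp _; rewrite ltnS; move: (dhomog_mf ph mp) => /= ->.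
Qed.

Lemma exists_std n : exists std : 'X_{1..n} -> nat -> 'X_{1..n + n},
  forall a p, (p <= mdeg a)%N -> multideg (std a p) = a /\ xdeg (std a p) = p.
Proof.
have : forall ap : 'X_{1..n} * nat, exists m : 'X_{1..n + n},
    (ap.2 <= mdeg ap.1)%N -> multideg m = ap.1 /\ xdeg m = ap.2.
  move=> [a p] /=; case: (boolP (p <= mdeg a)%N) => [/exists_monomial[m mP]|_].
    by exists m.
  (* A default value: no monomial has x-degree above its total degree. *)
  by exists 0%MM.
by move=> /choice[f fP]; exists (fun a p => f (a, p)) => a p; apply: (fP (a, p)).
Qed.

(** * Adjoining universal vertices to a graph *)

Section Extension.
Variables (K : fieldType) (n h : nat) (a : rel 'I_n) (b : rel 'I_h).
Variable e : 'I_h -> 'I_n.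
Hypotheses (asym : ssrbool.symmetric a) (e_inj : injective e).
Hypothesis ab : forall i j, a (e i) (e j) = b i j.
Hypothesis a_univ : forall w i, w \notin codom e -> w != i -> a w i.

Definition incl : {mpoly K[h + h]} -> {mpoly K[n + n]} :=
  xyeval (@mpolyC _ K) (fun i => xvar (e i)) (fun i => yvar (e i)).

Definition e_inv (k : 'I_n) : option 'I_h := [pick i | e i == k].

(** Killing the variables of the added vertices gives a left inverse of [incl], by which relations
    descend to the smaller vertex set. *)
Definition retr : {mpoly K[n + n]} -> {mpoly K[h + h]} :=
  xyeval (@mpolyC _ K) (fun k => oapp (fun i => xvar i) 0 (e_inv k))
    (fun k => oapp (fun i => yvar i) 0 (e_inv k)).

HB.instance Definition _ := GRing.RMorphism.on incl.
HB.instance Definition _ := GRing.RMorphism.on retr.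

Lemma e_invK i : e_inv (e i) = Some i.
Proof.
by rewrite /e_inv; case: pickP => [j /eqP/e_inj->|/(_ i)] //; rewrite eqxx.
Qed.

Lemma e_inv_some k i : e_inv k = Some i -> k = e i.
Proof. by rewrite /e_inv; case: pickP => // j /eqP <- [<-]. Qed.

Lemma inclZ c p : incl (c *: p) = c *: incl p.
Proof. by rewrite -[RHS]mul_mpolyC; exact: xyevalZ. Qed.

Lemma inclK p : retr (incl p) = p.
Proof.
apply: (@mpoly_rmorph_eq _ _ _ (retr \o incl) idfun) => [c|k] /=.
  by rewrite /incl /retr /xyeval !mmapC.
case: (splitP k) => i ki.
  have -> : k = lshift h i by apply: val_inj.
  by rewrite /incl xyeval_x /retr xyeval_x e_invK.
have -> : k = rshift h i by apply: val_inj.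
by rewrite /incl xyeval_y /retr xyeval_y e_invK.
Qed.

(** A minor that involves an added vertex goes to 0, any other one to a minor. The relations are
    free because both the given adjacencies and [neq] are needed. *)
Lemma retr_edge_ideal (a' : rel 'I_n) (b' : rel 'I_h) p :
    ssrbool.symmetric b' -> irreflexive a' ->
    (forall i j, a' (e i) (e j) -> b' i j) ->
  edge_ideal a' p -> edge_ideal b' (retr p).
Proof.
move=> bsym airr a'b'; apply: xyeval_edge_ideal => i j aij.
case ei: (e_inv i) => [i'|] /=; last by rewrite mul0r mulr0 subrr; exact: edge_ideal0.
case ej: (e_inv j) => [j'|] /=; last by rewrite mul0r mulr0 subrr; exact: edge_ideal0.
move: aij; rewrite (e_inv_some ei) (e_inv_some ej) => aij.
apply: edge_ideal_minor; rewrite ?a'b' //; apply: contraTneq aij => ->.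
by rewrite airr.
Qed.

Lemma incl_neq p : edge_ideal neq p -> edge_ideal neq (incl p).
Proof.
apply: xyeval_edge_ideal => i j ij; apply: edge_ideal_minor => //.
  by move=> ? ?; rewrite eq_sym.
all: by rewrite (inj_eq e_inj).
Qed.

Lemma incl_retr_monomial (m : 'X_{1..n + n}) :
    (forall k, (0 < multideg m k)%N -> k \in codom e) ->
  incl (retr 'X_[m]) = 'X_[m].
Proof.
move=> supp; rewrite mpolyXE_id !rmorph_prod; apply: eq_bigr => k _ /=.
rewrite !rmorphXn /=; have [->|k0] := posnP (m k); first by rewrite !expr0.
congr (_ ^+ _); case: (splitP k) => i ki.
  have kE : k = lshift n i by apply: val_inj.
  have /codomP[j ij] : i \in codom e.
    by apply: supp; rewrite mnmE -kE ltn_addr.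
  by rewrite kE ij /retr xyeval_x e_invK /incl xyeval_x.
have kE : k = rshift n i by apply: val_inj.
have /codomP[j ij] : i \in codom e.
  by apply: supp; rewrite mnmE -kE ltn_addl.
by rewrite kE ij /retr xyeval_y e_invK /incl xyeval_y.
Qed.

(** If w is i or j, the minor itself belongs to an edge. Otherwise x_w or y_w divides m, and the
    relation [i j] x_w = x_i [w j] - x_j [w i] between minors, or its analogue with y, applies. *)
Lemma univ_swap (m : 'X_{1..n + n}) w i j : w \notin codom e -> i != j ->
  (0 < multideg (m + U_(lshift n i) + U_(rshift n j))%MM w)%N ->
  edge_ideal a ('X_[m] * minor2 i j : {mpoly K[n + n]}).
Proof.
move=> we ij mw; have aw k : w != k -> edge_ideal a (minor2 w k : {mpoly K[n + n]}).
  by move=> wk; apply: edge_ideal_minor => //; apply: a_univ.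
have [wi|wi] := eqVneq w i; first by subst; apply/edge_idealM/aw.
have [wj|wj] := eqVneq w j.
  subst; rewrite -opprB mulrN; apply/edge_idealN/edge_idealM/aw.
  by rewrite eq_sym.
have {mw} : (0 < m (lshift n w) + m (rshift n w))%N.
  move: mw; rewrite !mnmE !eq_lshift !eq_rshift eq_lrshift eq_rlshift.
  by rewrite ![_ == w]eq_sym (negPf wi) (negPf wj) !addn0.
have div k : (0 < m k)%N -> 'X_[m] = 'X_[m - U_(k)] * 'X_k :> {mpoly K[n + n]}.
  move=> mk; rewrite -mpolyXD submK //; apply/mnm_lepP => l.
  by rewrite mnmE; case: eqP => [<-|].
have swapD (p q : {mpoly K[n + n]}) :
    edge_ideal a (p * minor2 w j - q * minor2 w i).
  apply: edge_idealD; last apply: edge_idealN; exact/edge_idealM/aw.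
rewrite addn_gt0 => /orP[|] /div->; rewrite -mulrA; apply: edge_idealM.
  have -> : xvar w * minor2 i j = xvar i * minor2 w j - xvar j * minor2 w i
    :> {mpoly K[n + n]} by ring.
  exact: swapD.
have -> : yvar w * minor2 i j = yvar i * minor2 w j - yvar j * minor2 w i
  :> {mpoly K[n + n]} by ring.
exact: swapD.
Qed.

Lemma incl_homog d p : p \is d.-homog -> incl p \is d.-homog.
Proof. by apply: xyeval_homog => i; rewrite dhomogX /= mdeg1. Qed.

Lemma retr_homog d p : p \is d.-homog -> retr p \is d.-homog.
Proof.
by apply: xyeval_homog => i; case: (e_inv i) => [j|] /=;
  rewrite ?rpred0 // dhomogX /= mdeg1.
Qed.

Hypotheses (airr : irreflexive a) (bsym : ssrbool.symmetric b).

Lemma incl_edge_ideal p : edge_ideal b p -> edge_ideal a (incl p).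
Proof.
apply: xyeval_edge_ideal => i j; rewrite -ab => aij.
by apply: edge_ideal_minor => //; apply: contraTneq aij => ->; rewrite airr.
Qed.

Lemma retr_sub_monomials (m m' : 'X_{1..n + n}) :
    multideg m = multideg m' -> xdeg m = xdeg m' ->
  edge_ideal neq (retr ('X_[m] - 'X_[m'])).
Proof.
move=> mm' xx'.
apply: (@swap_monomials K n (fun p => edge_ideal neq (retr p)) xpredT) => //.
- by rewrite rmorph0; exact: edge_ideal0.
- by move=> p q; rewrite rmorphD; exact: edge_idealD.
move=> m0 i j ij _; rewrite rmorphM; apply: edge_idealM.
apply: (@retr_edge_ideal neq) => [? ?|?|? ?|]; rewrite ?eqxx //=.
- by rewrite eq_sym.
- by apply: contra => /eqP->.
by apply: edge_ideal_minor => // ? ?; rewrite eq_sym.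
Qed.

(** Modulo the edge ideal of [b], the dimension of this space is the correction delta_d. *)
Definition complete_part d (p : {mpoly K[h + h]}) : Prop :=
  p \is d.-homog /\ edge_ideal neq p.

(** The basis consists of one monomial for each multidegree of degree d and each x-degree from 0 to
    d, and of the images of the basis [B] of the complete part. *)
Lemma extension_basis d N (B : 'I_N -> {mpoly K[h + h]}) :
    (forall j, complete_part d (B j)) -> free_mod (edge_ideal b) B ->
    (forall p, complete_part d p -> span_mod (edge_ideal b) B p) ->
  exists F : {t | t \in mpoly.basis n d} * 'I_d.+1 + 'I_N -> {mpoly K[n + n]},
    [/\ forall j, F j \is d.-homog, free_mod (edge_ideal a) F &
        forall p, p \is d.-homog -> span_mod (edge_ideal a) F p].
Proof.
move=> BA Bfree Bspan; have [std stdP] := exists_std n.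
pose st (t : {t | t \in mpoly.basis n d}) (p : 'I_d.+1) := std (s2m (val t)) p.
have degt (t : {t | t \in mpoly.basis n d}) : mdeg (s2m (val t)) = d.
  apply/eqP; rewrite basis_cover; apply/mapP; exists (val t) => //.
  by rewrite mem_enum; exact: valP.
have stP t p : multideg (st t p) = s2m (val t) /\ xdeg (st t p) = p.
  by apply: stdP; rewrite degt -ltnS.
pose F (j : {t | t \in mpoly.basis n d} * 'I_d.+1 + 'I_N) : {mpoly K[n + n]} :=
  match j with inl tp => 'X_[st tp.1 tp.2] | inr l => incl (B l) end.
have sumF c : \sum_j c j *: F j =
    \sum_tp c (inl tp) *: 'X_[st tp.1 tp.2] + incl (\sum_l c (inr l) *: B l).
  rewrite big_sumType; congr (_ + _); rewrite rmorph_sum.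
  by apply: eq_bigr => l _; rewrite /= inclZ.
exists F; split.
- case=> [[t p]|l] /=; last exact/incl_homog/(BA l).1.
  by rewrite dhomogX /= -mdeg_multideg (stP t p).1 degt.
- move=> c; rewrite sumF => Jc.
  have cB : edge_ideal neq (\sum_l c (inr l) *: B l).
    apply: (mod_sum (edge_ideal0 K neq) (@edge_idealP K _ neq)) => l _.
    by apply: (modZ (edge_ideal0 K neq) (@edge_idealP K _ neq)); exact: (BA l).2.
  (* [segre] kills the part coming from [B] and separates the chosen monomials, so one coefficient
     of the image isolates [c (inl tp)]. *)
  have c0 tp : c (inl tp) = 0.
    have := segre_edge_ideal Jc.
    rewrite rmorphD /= (segre_edge_ideal (incl_neq cB)) addr0 rmorph_sum.
    move=> /(congr1 (fun q : {poly {mpoly K[n]}} => q`_tp.2 @_(s2m (val tp.1)))).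
    rewrite coef0 mcoeff0 coef_sum raddf_sum (bigD1 tp) //= big1 => [|[t p] tpN].
      rewrite segreZ segreX (stP _ _).1 (stP _ _).2 mulrA -polyCM coefCM coefXn.
      by rewrite eqxx mulr1 mcoeffCM mcoeffX eqxx mulr1 addr0.
    rewrite segreZ segreX (stP _ _).1 (stP _ _).2 mulrA -polyCM coefCM coefXn.
    have [e2|_] := eqVneq; last by rewrite mulr0 mcoeff0.
    rewrite mulr1 mcoeffCM mcoeffX; have [e1|_] := eqVneq; last by rewrite mulr0.
    case/eqP: tpN; rewrite [RHS]surjective_pairing; congr (_, _).
      apply/val_inj/inj_s2m => //; exact: valP.
    exact/val_inj/esym.
  rewrite big1 ?add0r in Jc => [|tp _]; last by rewrite c0 scale0r.
  case=> [tp|l]; first exact: c0.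
  (* Only [incl] of a combination of [B] is left; [retr] brings that relation back to the small
     graph. *)
  apply: (Bfree (fun l => c (inr l))); rewrite -[X in edge_ideal b X]inclK.
  by apply: (@retr_edge_ideal a b) Jc => // i j; rewrite ab.
move=> p ph; rewrite [p]mpolyE big_seq.
have spanP := span_modP (@edge_idealP K n a).
have J0 := edge_ideal0 K a.
apply: span_mod_sum => // [? ? ?|m mp]; first exact: edge_idealP.
rewrite -[_ *: _]addr0; apply: (spanP); last exact: span_mod0.
have mdm : mdeg m = d := dhomog_mf ph mp.
have : multideg m \in [seq s2m t | t : d.-tuple 'I_n <- enum (mpoly.basis n d)].
  by rewrite -basis_cover mdeg_multideg mdm.
move=> /mapP[t]; rewrite mem_enum => tb mt.
have xm : (xdeg m < d.+1)%N by rewrite ltnS -mdm xdeg_le.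
pose m' := st (exist _ t tb) (Ordinal xm).
have [m'm m'x] := stP (exist _ t tb) (Ordinal xm); rewrite -/m' /= -mt in m'm m'x.
rewrite -[X in span_mod _ _ X](subrK 'X_[m']) addrC -['X_[m']]scale1r.
apply: spanP.
  exists (fun j => (j == inl (exist _ t tb, Ordinal xm))%:R).
  rewrite (bigD1 (inl (exist _ t tb, Ordinal xm))) //= eqxx scale1r big1.
    by rewrite addr0 subrr.
  by move=> j /negPf->; rewrite scale0r.
(* If an added vertex occurs in m, exchanges show that m agrees with m' modulo the ideal; otherwise
   m - m' comes from the complete part of the small graph. *)
case: (boolP [exists w, (w \notin codom e) && (0 < multideg m w)%N]).
  case/existsP=> w /andP[we mw]; apply: span_mod0; rewrite scale1r.
  apply: (@swap_monomials K n (edge_ideal a) (fun d => (0 < d w)%N)) => //.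
  - by move=> ? ?; exact: edge_idealD.
  - by move=> m0 i j; exact: univ_swap.
rewrite negb_exists => /forallP supp.
have {}supp k : (0 < multideg m k)%N -> k \in codom e.
  by move=> mk; have := supp k; rewrite mk andbT negbK.
have -> : 'X_[m] - 1 *: 'X_[m'] = incl (retr ('X_[m] - 'X_[m'])).
  by rewrite scale1r !rmorphB /= !incl_retr_monomial ?m'm.
have [c cJ] : span_mod (edge_ideal b) B (retr ('X_[m] - 'X_[m'])).
  apply: Bspan; split; last exact: retr_sub_monomials.
  apply: retr_homog; apply: rpredB; rewrite dhomogX /= ?mdm //.
  by rewrite -mdeg_multideg m'm mdeg_multideg mdm.
exists (fun j => match j with inl _ => 0 | inr l => c l end).
rewrite sumF big1 ?add0r => [|tp _]; last by rewrite scale0r.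
by rewrite -rmorphB; exact: incl_edge_ideal.
Qed.

End Extension.

(** * Hilbert functions of joins with complete graphs *)

Section HilbertFunction.
Variable K : fieldType.

Definition ord_adj (G : sgraph) : rel 'I_#|G| :=
  fun i j => adj (enum_val i) (enum_val j).

Lemma in_binomial_edge_ideal (G : sgraph) p :
  p \in @binomial_edge_ideal K G <-> edge_ideal (@ord_adj G) p.
Proof. by split=> [/asboolP|Jp]; last exact/asboolP. Qed.

Lemma graded_dimP (G : sgraph) d N :
    graded_dim (@binomial_edge_ideal K G) d N ->
  exists B : 'I_N -> {mpoly K[#|G| + #|G|]},
    [/\ forall j, B j \is d.-homog, free_mod (edge_ideal (@ord_adj G)) B &
        forall p, p \is d.-homog -> span_mod (edge_ideal (@ord_adj G)) B p].
Proof.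
move=> [B [Bh Bfree Bspan]]; exists B; split=> // [c Jc|p ph].
  apply: Bfree; apply/eqP; rewrite -Quotient.idealrBE subr0.
  exact/in_binomial_edge_ideal.
have [c /eqP] := Bspan p ph; rewrite -Quotient.idealrBE => Jc.
by exists c; apply/in_binomial_edge_ideal.
Qed.

(** [delta d] is the dimension of the complete part of [H] modulo its edge ideal, hence is chosen
    before [t]. The second clause serves to prove it nonzero in degree 2. *)
Lemma hilbert_function_join (H : sgraph) : exists delta : nat -> nat,
  (forall t d N, (1 <= t)%N ->
     graded_dim (@binomial_edge_ideal K (join H (complete_graph t))) d N ->
     N = (d.+1 * 'C(d + (#|H| + t).-1, d) + delta d)%N) /\
  (forall d (p : {mpoly K[#|H| + #|H|]}), delta d = 0%N -> p \is d.-homog ->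
     edge_ideal neq p -> edge_ideal (@ord_adj H) p).
Proof.
pose J := edge_ideal (K := K) (@ord_adj H).
have J0 : J 0 := edge_ideal0 _ _; have JP := @edge_idealP K _ (@ord_adj H).
have /choice[delta BP] : forall d, exists N (b : 'I_N -> {mpoly K[#|H| + #|H|]}),
    [/\ forall j, complete_part d (b j), free_mod J b &
        forall p, complete_part d p -> span_mod J b p].
  move=> d; pose X (k : bmultinom (#|H| + #|H|) d.+1) : {mpoly K[#|H| + #|H|]} := 'X_[k].
  apply: (@exists_basis_mod K _ J J0 JP (@complete_part K #|H| d) _ X).
  by move=> p [/homog_span[c pE] _]; exists c; rewrite {1}pE subrr.
exists delta; split; last first.
  move=> d p delta0 ph Jp; have [B [_ _ Bspan]] := BP d.
  have [c] := Bspan p (conj ph Jp).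
  by rewrite big1 ?subr0 // => j; have := ltn_ord j; rewrite {2}delta0.
move=> t d N t1 /graded_dimP[B' [B'h B'free B'span]].
set G := join H (complete_graph t) in B' B'h B'free B'span.
pose e (i : 'I_#|H|) : 'I_#|G| := enum_rank (inl (enum_val i) : G).
have e_inj : injective e by move=> i j /enum_rank_inj[] /enum_val_inj.
have asym : ssrbool.symmetric (@ord_adj G) by move=> i j; exact: adj_sym.
have airr : irreflexive (@ord_adj G) by move=> i; exact: adj_irr.
have bsym : ssrbool.symmetric (@ord_adj H) by move=> i j; exact: adj_sym.
have ab i j : ord_adj (e i) (e j) = ord_adj i j by rewrite /ord_adj !enum_rankK.
have a_univ w i : w \notin codom e -> w != i -> ord_adj w i.
  move=> we wi; rewrite /ord_adj; case: (enum_val w) (enum_valK w) => [x|x] xw.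
    by case/negP: we; apply/codomP; exists (enum_rank x); rewrite /e enum_rankK.
  case: (enum_val i) (enum_valK i) => [//|y] yi /=.
  by apply: contraNneq wi => xy; rewrite -xw -yi xy.
have [B [BA Bfree Bspan]] := BP d.
have [F [Fh Ffree Fspan]] :=
  extension_basis asym e_inj ab a_univ airr bsym BA Bfree Bspan.
have J0' := edge_ideal0 K (@ord_adj G); have JP' := @edge_idealP K _ (@ord_adj G).
(* There are C(d + n - 1, d) multidegrees of degree d in n = [#|G|] variables, each with d + 1
   x-degrees. *)
have -> : (d.+1 * 'C(d + (#|H| + t).-1, d) + delta d)%N =
    #|{: {t | t \in mpoly.basis #|G| d} * 'I_d.+1 + 'I_(delta d)}|.
  rewrite card_sum card_prod !card_ord card_sig mulnC; congr (_ * _ + _)%N.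
  have [n nE] : exists n, #|G| = n.+1.
    by exists (#|H| + t).-1; rewrite card_join card_ord; lia.
  have -> : (#|H| + t).-1 = n by move: nE; rewrite card_join card_ord => ->.
  by rewrite nE -size_basis size_map -cardE.
apply/eqP; rewrite -[N in (N == _)]card_ord eqn_leq.
apply/andP; split.
  by apply: (free_mod_card_le J0' JP' B'free (b' := F)) => j; exact/Fspan.
by apply: (free_mod_card_le J0' JP' Ffree (b' := B')) => j; exact/B'span.
Qed.

(** The minor of the vertices 0 and 2, which are not adjacent, is the witness. *)
Lemma path_edge_ideal_proper m : (3 <= m)%N ->
  exists p : {mpoly K[#|path_graph m| + #|path_graph m|]},
    [/\ p \is 2.-homog, edge_ideal neq p & ~ edge_ideal (@ord_adj (path_graph m)) p].
Proof.
move=> m3; pose v0 : path_graph m := Ordinal (leq_trans (isT : 1 <= 3)%N m3).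
pose v2 : path_graph m := Ordinal m3.
pose i := enum_rank v0; pose j := enum_rank v2.
have ij : i != j by rewrite (inj_eq enum_rank_inj).
exists (minor2 i j); split.
- by apply: rpredB; rewrite -mpolyXD dhomogX /= mdegD !mdeg1.
- by apply: edge_ideal_minor => // ? ?; rewrite eq_sym.
(* At the point x = e_i, y = e_j the only nonzero product x_k y_l is x_i y_j, and i, j is no edge:
   the generators vanish there, while the witness takes the value 1. *)
pose u k : K := (k == i)%:R; pose v k : K := (k == j)%:R.
have uv k l : ord_adj k l -> u k * v l = u l * v k.
  have uv0 k' l' : ord_adj k' l' -> u k' * v l' = 0.
    rewrite /u /v; have [->|_] := eqVneq k' i; last by rewrite mul0r.
    have [->|_] := eqVneq l' j; last by rewrite mulr0.
    by rewrite /ord_adj !enum_rankK.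
  by move=> kl; rewrite !uv0 // /ord_adj adj_sym.
move=> /(xyeval_edge_ideal0 idfun uv); rewrite xyeval_minor /u /v !eqxx.
by rewrite eq_sym (negPf ij) mulr0 subr0 mulr1 => /eqP; rewrite oner_eq0.
Qed.

End HilbertFunction.

(** * Growth of the degrees, and the limits *)

Lemma h_degree_join_path (K : fieldType) (m : nat) (h : nat -> {poly int}) :
    (3 <= m)%N ->
    (forall t, (1 <= t)%N ->
       h_polynomial K (join (path_graph m) (complete_graph t)) (h t)) ->
  exists c, forall t, (1 <= t)%N -> (t <= (size (h t)).-1 + c)%N.
Proof.
move=> m3 hP; have [delta [dimE delta0]] := hilbert_function_join K (path_graph m).
have d2 : (delta 2)%:Z != 0.
  have [p [ph Jp NJp]] := path_edge_ideal_proper K m3.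
  by apply: contra_notN NJp => /eqP[d2]; exact: (delta0 2).
(* The exponent is the Krull dimension, with a dummy value at t = 0; [m.-1 + t] is the number of
   vertices minus one. *)
have /choice[d dP] : forall t, exists d, (1 <= t)%N -> forall i, (h t)`_i =
    pact ((1 - 'X) ^+ d) (fun k => (k.+1 * 'C(k + (m.-1 + t), k))%N%:Z + (delta k)%:Z) i.
  move=> t; case: (posnP t) => [->|t1]; first by exists 0%N.
  have [d [H [_ dimH hE]]] := hP t t1; exists d => _ i.
  rewrite hE; apply: eq_bigr => j _; congr (_ * _).
  rewrite (dimE _ _ _ t1 (dimH _)) PoszD card_ord; congr (Posz (_ * 'C(_ + _, _)) + _).
  lia.
by apply: (h_degree_unbounded (d := d) (delta := Posz \o delta) d2) => t i t1; exact: dP.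
Qed.

Local Open Scope classical_set_scope.
Local Open Scope ring_scope.

Theorem mainTheorem4 (K : fieldType) (R : realType) (m : nat) (hm : (3 <= m)%N) :
  let G := fun t : nat => join (path_graph m) (complete_graph t) in
  [/\ forall t, (1 <= t)%N -> strongly_interval R (G t),
      forall s t, (1 <= s)%N -> (1 <= t)%N -> giso (G s) (G t) -> s = t,
      (fun t => (nb_maximal_cliques (G t))%:R / (#|G t|%:R - 2) : R)
        @ \oo --> (0 : R) &
      forall h : nat -> {poly int},
        (forall t, (1 <= t)%N -> h_polynomial K (G t) (h t)) ->
        (fun t => (nb_maximal_cliques (G t))%:R / (size (h t)).-1%:R : R)
          @ \oo --> (0 : R)].
Proof.
move=> G; have cG t : (nb_maximal_cliques (G t) <= 2 ^ #|path_graph m|)%N.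
  exact: nb_maximal_cliques_join.
split=> [t t1|s t _ _|| h hP].
- exact: strongly_interval_join_path.
(* The number of vertices, m + t, determines t. *)
- by move=> /giso_card; rewrite !card_join !card_ord => /addnI.
- apply: (cvg_bounded_ratio (c := 2) cG) => t _.
  by rewrite lerD2r ler_nat card_join !card_ord leq_addl.
have [c cP] := h_degree_join_path hm hP.
apply: (cvg_bounded_ratio (c := c) cG) => t t1.
by rewrite lerBlDr -natrD ler_nat cP.
Qed.
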